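(* Let $X$ be an infinite set. (i) $\operatorname{rank}(\mathcal{PB}_X:\mathcal F_X)=2$. (ii) If $\alpha,\beta\in\mathcal{PB}_X$, then $\mathcal{PB}_X=\langle\mathcal F_X\cup\{\alpha,\beta\}\rangle$ if and only if, after possibly interchanging $\alpha$ and $\beta$, we have $\alpha\in\mathcal G_X^R$, $\beta\in\mathcal G_X^L$ and $\operatorname{codef}(\alpha)=\operatorname{def}(\beta)=|X|$.
   Context: Partial Brauer monoid. Let $X$ be a set and $X'=\{x':x\in X\}$ a disjoint copy of $X$. A Brauer graph is an (undirected) graph with vertex set $X\cup X'$ in which every vertex has degree at most $1$; $\mathcal{PB}_X$ is the set of all of them. Product: let $X''=\{x'':x\in X\}$ be another disjoint copy of $X$; given $\alpha,\beta\in\mathcal{PB}_X$, let $\alpha^\vee$ be $\alpha$ with each vertex $x'$ renamed $x''$, let $\beta^\wedge$ be $\beta$ with each vertex $x\in X$ renamed $x''$, and let $\Pi(\alpha,\beta)$ be the graph on $X\cup X'\cup X''$ with all edges of $\alpha^\vee$ and $\beta^\wedge$. Then $\alpha\beta$ is the graph on $X\cup X'$ with an edge $\{x,y\}$ whenever $x,y\in X\cup X'$ are distinct and lie in the same connected component of $\Pi(\alpha,\beta)$. This makes $\mathcal{PB}_X$ a monoid with identity the graph with edge set $\{\{x,x'\}:x\in X\}$. A transversal of $\alpha$ is an edge $\{x,y'\}$ with $x,y\in X$ (possibly $x=y$). $\operatorname{Dom}(\alpha)$ is the set of $x\in X$ such that $x$ belongs to a transversal of $\alpha$; $\operatorname{Codom}(\alpha)$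 is the set of $x\in X$ such that $x'$ belongs to a transversal; $\operatorname{def}(\alpha)=|X\setminus\operatorname{Dom}(\alpha)|$ and $\operatorname{codef}(\alpha)=|X\setminus\operatorname{Codom}(\alpha)|$. In a monoid $M$, an element $x$ is a left unit if $ax=1$ for some $a\in M$, a right unit if $xb=1$ for some $b\in M$, and a unit if it is both. $\mathcal G_X^L$, $\mathcal G_X^R$ and $\mathcal G_X$ denote the submonoids of all left units, right units, and units of $\mathcal{PB}_X$. $\mathcal F_X$ denotes the subsemigroup of $\mathcal{PB}_X$ generated by all idempotents of $\mathcal{PB}_X$ together with $\mathcal G_X$. For a subset $U$ of a semigroup $S$, $\langle U\rangle$ is the subsemigroup generated by $U$. For $A\subseteq S$, the relative rank is $\operatorname{rank}(S:A)=\min\{|U| : U\subseteq S,\ S=\langle A\cup U\rangle\}$. *)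

(* Defs.v *)
From HB Require Import structures.
From Stdlib Require Import Relation_Operators Operators_Properties.
From mathcomp Require Import all_boot.
From mathcomp Require Import mathcomp_extra boolp classical_sets functions cardinality.

Set Implicit Arguments.
Unset Strict Implicit.
Unset Printing Implicit Defensive.

Local Open Scope classical_set_scope.
Local Open Scope card_scope.
Local Open Scope group_scope.

Section Semigroups.
Variable S : semigroupType.

Definition subsemigroup (M : set S) : Prop :=
  forall a b : S, M a -> M b -> M (a * b).

Definition gen (U : set S) : set S := smallest subsemigroup U.

(* Cardinal numbers are represented by arbitrary sets of that cardinality:
   [relrank_eq A K] reads "rank(S : A) = |K|", the minimum being attained. *)
Definition relrank_eq (A : set S) (T : Type) (K : set T) : Prop :=
  (exists2 U : set S, gen (A `|` U) = setT & U #= K) /\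
  (forall U : set S, gen (A `|` U) = setT -> K #<= U).
End Semigroups.

Section Units.
Variable M : monoidType.

Definition left_unit (x : M) : Prop := exists a, a * x = 1.
Definition right_unit (x : M) : Prop := exists b, x * b = 1.
Definition unit_elt (x : M) : Prop := left_unit x /\ right_unit x.
End Units.

(* The vertex set X ∪ X' is [X + X]: [inl x] is x and [inr x] is x'. *)
Record brauer (X : Type) := Brauer {
  edge : X + X -> X + X -> Prop;
  edge_sym : forall u v, edge u v -> edge v u;
  edge_irr : forall u, ~ edge u u;
  edge_deg : forall u v w, edge u v -> edge u w -> v = w }.

Section Product.
Variable X : Type.
Implicit Types a b c : brauer X.

Lemma brauer_ext a b : (forall u v, edge a u v <-> edge b u v) -> a = b.
Proof.
case: a b => [e es ei ed] [f fs fi fd] /= h.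
have ef : e = f by apply/funext => u; apply/funext => v; apply/propext.
by subst f; congr Brauer; apply: Prop_irrelevance.
Qed.

(* x, x'' and x' respectively *)
Inductive vertex3 := Top of X | Mid of X | Bot of X.

Definition ren_vee (u : X + X) : vertex3 :=
  match u with inl x => Top x | inr x => Mid x end.
Definition ren_wedge (u : X + X) : vertex3 :=
  match u with inl x => Mid x | inr x => Bot x end.
Definition outer (u : X + X) : vertex3 :=
  match u with inl x => Top x | inr x => Bot x end.

Inductive prod_edge a b : vertex3 -> vertex3 -> Prop :=
| prod_edge_vee u v : edge a u v -> prod_edge a b (ren_vee u) (ren_vee v)
| prod_edge_wedge u v : edge b u v -> prod_edge a b (ren_wedge u) (ren_wedge v).

(* [prod_edge a b] is symmetric, so paths need not be traversed backwards. *)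
Definition prod_connected a b : vertex3 -> vertex3 -> Prop :=
  clos_refl_trans vertex3 (prod_edge a b).

Definition mul_edge a b (u v : X + X) : Prop :=
  u <> v /\ prod_connected a b (outer u) (outer v).

Lemma prod_edge_sym a b p q : prod_edge a b p q -> prod_edge a b q p.
Proof. by case=> u v /edge_sym; constructor. Qed.

Lemma prod_connected_sym a b p q :
  prod_connected a b p q -> prod_connected a b q p.
Proof.
elim=> [r s /prod_edge_sym|r|r s t _ + _ h]; [exact: rt_step|exact: rt_refl|].
exact: rt_trans.
Qed.

Lemma ren_vee_inj : injective ren_vee.
Proof. by move=> [x|x] [y|y] //= [->]. Qed.
Lemma ren_wedge_inj : injective ren_wedge.
Proof. by move=> [x|x] [y|y] //= [->]. Qed.
Lemma outer_inj : injective outer.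
Proof. by move=> [x|x] [y|y] //= [->]. Qed.

(* A path in the product graph can be taken to alternate between edges of the
   first factor and edges of the second; such a path is determined by its
   starting point and the factor of its first edge. *)
Definition coloured a b (i : bool) (p q : vertex3) : Prop :=
  if i then exists u v, [/\ edge a u v, p = ren_vee u & q = ren_vee v]
  else exists u v, [/\ edge b u v, p = ren_wedge u & q = ren_wedge v].

Lemma coloured_sym a b i p q : coloured a b i p q -> coloured a b i q p.
Proof. by case: i => -[u [v [/edge_sym h -> ->]]]; exists v, u. Qed.

Lemma coloured_det a b i p q r :
  coloured a b i p q -> coloured a b i p r -> q = r.
Proof.
case: i => -[u [v [h -> ->]]] [u' [v' [h' + ->]]].
  by move/ren_vee_inj=> e; subst u'; rewrite (edge_deg h h').
by move/ren_wedge_inj=> e; subst u'; rewrite (edge_deg h h').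
Qed.

Lemma prod_edge_coloured a b p q :
  prod_edge a b p q -> exists i, coloured a b i p q.
Proof. by case=> u v h; [exists true|exists false]; exists u, v. Qed.

Inductive alternating a b : bool -> vertex3 -> vertex3 -> bool -> Prop :=
| alt_nil i p : alternating a b i p p i
| alt_cons i j p q r : coloured a b i p q -> alternating a b (~~ i) q r j ->
    alternating a b i p r j.

Lemma connected_alternating a b p q :
  prod_connected a b p q -> exists i j, alternating a b i p q j.
Proof.
move=> pq; have {pq}: clos_refl_trans_1n _ (prod_edge a b) p q.
  exact: clos_rt_rt1n.
elim=> [r|r s t /prod_edge_coloured[i rs] _ [k [j st]]].
  by exists true, true; apply: alt_nil.
case: st i rs => {s t k j} [k s|k j s s' t ss' st] i rs.
  by exists i, (~~ i); apply: alt_cons rs (alt_nil _ _ _ _).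
have [ik|ik] := eqVneq i k.
  subst k; exists (~~ i), j.
  by rewrite (coloured_det (coloured_sym rs) ss').
exists i, j; apply: (alt_cons rs).
have -> : ~~ i = k by case: i k ik {rs ss' st} => [] [].
exact: alt_cons ss' st.
Qed.

Definition stuck a b i p := forall q, ~ coloured a b i p q.

Lemma alternating_det a b i p q q' j j' :
  alternating a b i p q j -> alternating a b i p q' j' ->
  stuck a b j q -> stuck a b j' q' -> q = q'.
Proof.
move=> H; elim: H q' j' => {i p q j}.
  by move=> i p q' j' [//|{}i j {}p q r pq _ /(_ q)].
move=> i j p q r pq qr IH q' j' H; case: H pq qr IH => {i p q' j'}.
  by move=> i p pq _ _ _ /(_ q).
move=> i j' p q2 r' pq2 qr' pq qr IH.
by move: pq2 qr' => /(coloured_det pq) <-; apply: IH.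
Qed.

Definition is_top (u : X + X) : bool := if u is inl _ then true else false.

Lemma coloured_outer a b i u q : coloured a b i (outer u) q -> i = is_top u.
Proof. by case: i u => [] [x|x] [[y|y] [w [_ +]]]. Qed.

Lemma alternating_first a b i p q j :
  alternating a b i p q j -> p <> q -> exists r, coloured a b i p r.
Proof. by case=> // {}i {}j {}p r {}q pr _ _; exists r. Qed.

Lemma alternating_last a b i p q j :
  alternating a b i p q j -> p <> q -> exists r, coloured a b (~~ j) r q.
Proof.
move=> H; suff [[]//|//] : (p = q /\ i = j) \/ exists r, coloured a b (~~ j) r q.
elim: H => {i p q j} [|i j p q r pq _ [[<- <-]|]]; [by left| |by right].
by right; exists p; rewrite negbK.
Qed.

Lemma mul_edge_deg a b u v w : mul_edge a b u v -> mul_edge a b u w -> v = w.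
Proof.
have E t : mul_edge a b u t -> exists2 j,
    alternating a b (is_top u) (outer u) (outer t) j & stuck a b j (outer t).
  case=> ut /connected_alternating [i [j H]].
  have uot : outer u <> outer t by move/outer_inj.
  exists j.
    by have [r /coloured_outer <-] := alternating_first H uot.
  have [r /coloured_sym/coloured_outer jt] := alternating_last H uot.
  by move=> q /coloured_outer; rewrite -jt; case: (j).
move=> /E[j uv sv] /E[k uw sw].
exact/outer_inj/(alternating_det uv uw sv sw).
Qed.

Lemma mul_edge_sym a b u v : mul_edge a b u v -> mul_edge a b v u.
Proof. by case=> uv /prod_connected_sym vu; split => // /esym. Qed.

Lemma mul_edge_irr a b u : ~ mul_edge a b u u.
Proof. by case. Qed.

Definition brauer_mul a b : brauer X :=
  Brauer (@mul_edge_sym a b) (@mul_edge_irr a b) (@mul_edge_deg a b).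

Definition one_edge (u v : X + X) : Prop :=
  match u, v with inl x, inr y | inr x, inl y => x = y | _, _ => False end.

Lemma one_edge_sym u v : one_edge u v -> one_edge v u.
Proof. by case: u v => [x|x] [y|y] //= ->. Qed.

Lemma one_edge_irr u : ~ one_edge u u.
Proof. by case: u => x []. Qed.

Lemma one_edge_deg u v w : one_edge u v -> one_edge u w -> v = w.
Proof. by case: u v w => [x|x] [y|y] [z|z] //= -> ->. Qed.

Definition brauer_one : brauer X :=
  Brauer one_edge_sym one_edge_irr one_edge_deg.

Lemma clos_map (V W : Type) (f : V -> W) (R : V -> V -> Prop)
    (Q : W -> W -> Prop) :
  (forall p q, R p q -> clos_refl_trans W Q (f p) (f q)) ->
  forall p q, clos_refl_trans V R p q -> clos_refl_trans W Q (f p) (f q).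
Proof.
move=> h p q; elim=> [{}p {}q /h//|r|r s t _ + _]; first exact: rt_refl.
exact: rt_trans.
Qed.

(* Reflection in the horizontal axis, an anti-automorphism. *)
Definition flip (u : X + X) : X + X :=
  match u with inl x => inr x | inr x => inl x end.

Lemma flipK : involutive flip.
Proof. by case. Qed.

Definition star_edge a u v := edge a (flip u) (flip v).

Lemma star_edge_sym a u v : star_edge a u v -> star_edge a v u.
Proof. exact: edge_sym. Qed.

Lemma star_edge_irr a u : ~ star_edge a u u.
Proof. exact: edge_irr. Qed.

Lemma star_edge_deg a u v w : star_edge a u v -> star_edge a u w -> v = w.
Proof. by move=> uv /(edge_deg uv)/(inv_inj flipK). Qed.

Definition star a : brauer X :=
  Brauer (@star_edge_sym a) (@star_edge_irr a) (@star_edge_deg a).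

Lemma starK : involutive star.
Proof.
by move=> a; apply: brauer_ext => u v; rewrite /= /star_edge /= /star_edge !flipK.
Qed.

Lemma star_mul a b : star (brauer_mul a b) = brauer_mul (star b) (star a).
Proof.
pose f p := match p with Top x => Bot x | Mid x => Mid x | Bot x => Top x end.
have fo u : f (outer u) = outer (flip u) by case: u.
have H c d p q : prod_connected c d p q ->
    prod_connected (star d) (star c) (f p) (f q).
  apply: clos_map => {}p {}q [] u v uv; apply: rt_step.
    have E w : f (ren_vee w) = ren_wedge (flip w) by case: w.
    by rewrite !E; apply: prod_edge_wedge; rewrite /= /star_edge !flipK.
  have E w : f (ren_wedge w) = ren_vee (flip w) by case: w.
  by rewrite !E; apply: prod_edge_vee; rewrite /= /star_edge !flipK.
apply: brauer_ext => u v; rewrite /= /star_edge /=; split=> -[uv /H].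
  by rewrite !fo !flipK; split => // e; apply: uv; rewrite e.
by rewrite !starK !fo; split => // /(inv_inj flipK).
Qed.

Lemma star_one : star brauer_one = brauer_one.
Proof. by apply: brauer_ext => -[x|x] [y|y]. Qed.

Lemma brauer_mul1b : left_id brauer_one brauer_mul.
Proof.
move=> a; apply: brauer_ext => u v.
pose f p : X + X := match p with Top x | Mid x => inl x | Bot x => inr x end.
have fw w : f (ren_wedge w) = w by case: w.
have fo w : f (outer w) = w by case: w.
have c w : prod_connected brauer_one a (outer w) (ren_wedge w).
  case: w => x; last exact: rt_refl.
  by apply: rt_step; apply: (@prod_edge_vee _ _ (inl x) (inr x)).
split=> [[uv H]|auv].
  have: u = f (outer v) \/ edge a u (f (outer v)).
    have {}H : clos_refl_trans_n1 _ (prod_edge brauer_one a) (outer u) (outer v).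
      exact: clos_rt_rtn1.
    elim: H => [|p q pq _]; first by rewrite fo; left.
    case: pq => {p q}; first by move=> [x|x] [y|y] //= ->.
    move=> s t st; rewrite !fw => -[->|us]; first by right.
    by left; apply: edge_deg (edge_sym us) st.
  by rewrite fo => -[].
split=> [uv|]; first by subst v; case: (edge_irr auv).
apply: rt_trans (c u) _; apply: rt_trans (prod_connected_sym (c v)).
exact/rt_step/prod_edge_wedge.
Qed.

Lemma brauer_mulb1 : right_id brauer_one brauer_mul.
Proof.
by move=> a; rewrite -[LHS]starK star_mul star_one brauer_mul1b starK.
Qed.

(* Both bracketings of a triple product are read off the same four-level
   graph. *)
Inductive vertex4 := L0 of X | L1 of X | L2 of X | L3 of X.

Definition ren01 u := match u with inl x => L0 x | inr x => L1 x end.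
Definition ren12 u := match u with inl x => L1 x | inr x => L2 x end.
Definition ren23 u := match u with inl x => L2 x | inr x => L3 x end.
Definition outer4 u := match u with inl x => L0 x | inr x => L3 x end.

Inductive prod4_edge a b c : vertex4 -> vertex4 -> Prop :=
| prod4_edge01 u v : edge a u v -> prod4_edge a b c (ren01 u) (ren01 v)
| prod4_edge12 u v : edge b u v -> prod4_edge a b c (ren12 u) (ren12 v)
| prod4_edge23 u v : edge c u v -> prod4_edge a b c (ren23 u) (ren23 v).

Definition prod4_connected a b c :=
  clos_refl_trans vertex4 (prod4_edge a b c).

Lemma mul_mul_edge a b c u v :
  mul_edge (brauer_mul a b) c u v <->
  u <> v /\ prod4_connected a b c (outer4 u) (outer4 v).
Proof.
pose f p := match p with Top x => L0 x | Mid x => L1 x | Bot x => L2 x end.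
pose g p := match p with Top x => L0 x | Mid x => L2 x | Bot x => L3 x end.
have go w : g (outer w) = outer4 w by case: w.
have gw w : g (ren_wedge w) = ren23 w by case: w.
have gf w : g (ren_vee w) = f (outer w) by case: w.
have fv w : f (ren_vee w) = ren01 w by case: w.
have fw w : f (ren_wedge w) = ren12 w by case: w.
split=> -[uv H]; split=> //.
  rewrite -!go; move: H; apply: clos_map => p q [] {p q} s t.
    case=> _; rewrite !gf; apply: clos_map => p q [] {p q} {}s {}t st.
      by rewrite !fv; apply/rt_step/prod4_edge01.
    by rewrite !fw; apply/rt_step/prod4_edge12.
  by move=> st; rewrite !gw; apply/rt_step/prod4_edge23.
pose C := prod_connected (brauer_mul a b) c (outer u).
pose I q := exists w, C (ren_vee w) /\ prod_connected a b (outer w) q.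
pose J q := match q with
  L0 x => C (Top x) | L1 x => I (Mid x) | L2 x => C (Mid x) | L3 x => C (Bot x)
  end.
have JI q : J (f q) <-> I q.
  have K w : C (ren_vee w) <-> I (outer w).
    split=> [Cw|[w' [Cw' ww']]]; first by exists w; split => //; apply: rt_refl.
    have [<-//|ne] := EM (w' = w).
    apply: rt_trans Cw' _; exact/rt_step/prod_edge_vee.
  case: q => x //=; [exact: (K (inl x))|exact: (K (inr x))].
have J23 w : J (ren23 w) <-> C (ren_wedge w) by case: w.
have Istep p q : I p -> prod_edge a b p q -> I q.
  move=> [w [Cw wp]] pq; exists w; split => //.
  exact: rt_trans wp (rt_step _ _ _ _ pq).
have Jo w : J (outer4 w) <-> C (outer w) by case: w.
apply/Jo; have: J (outer4 u) by apply/Jo; apply: rt_refl.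
elim: H => [p q [] {p q} s t st|//|p q r _ h1 _ h2 /h1/h2//].
- by rewrite -!fv => /JI/Istep h; apply/JI/h/prod_edge_vee.
- by rewrite -!fw => /JI/Istep h; apply/JI/h/prod_edge_wedge.
move=> /J23 Cs; apply/J23; apply: rt_trans Cs _.
exact/rt_step/prod_edge_wedge.
Qed.

Lemma star_prod4 a b c u v :
  prod4_connected a b c (outer4 u) (outer4 v) ->
  prod4_connected (star c) (star b) (star a) (outer4 (flip u)) (outer4 (flip v)).
Proof.
pose f p :=
  match p with L0 x => L3 x | L1 x => L2 x | L2 x => L1 x | L3 x => L0 x end.
have E w : outer4 (flip w) = f (outer4 w) by case: w.
rewrite !E; apply: clos_map => p q [] {p q} {}u {}v uv; apply: rt_step.
- have E' w : f (ren01 w) = ren23 (flip w) by case: w.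
  by rewrite !E'; apply: prod4_edge23; rewrite /= /star_edge !flipK.
- have E' w : f (ren12 w) = ren12 (flip w) by case: w.
  by rewrite !E'; apply: prod4_edge12; rewrite /= /star_edge !flipK.
- have E' w : f (ren23 w) = ren01 (flip w) by case: w.
  by rewrite !E'; apply: prod4_edge01; rewrite /= /star_edge !flipK.
Qed.

Lemma brauer_mulA : associative brauer_mul.
Proof.
move=> a b c; apply: brauer_ext => u v.
rewrite -[brauer_mul a _]starK (star_mul a) (star_mul b).
apply: iff_trans (iff_sym (mul_mul_edge _ _ _ _ _)).
apply: (iff_trans (mul_mul_edge _ _ _ _ _)).
split=> -[uv /star_prod4 H]; split; rewrite ?starK ?flipK in H * => //.
- by move=> e; apply: uv; rewrite e.
- by move=> /(inv_inj flipK).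
Qed.
End Product.

HB.instance Definition _ (X : Type) := gen_eqMixin (brauer X).
HB.instance Definition _ (X : Type) := gen_choiceMixin (brauer X).
HB.instance Definition _ (X : Type) := isMonoid.Build (brauer X)
  (@brauer_mulA X) (@brauer_mul1b X) (@brauer_mulb1 X).

Section BrauerSets.
Variable X : Type.
Implicit Type a : brauer X.

Definition Dom a : set X := [set x | exists y, edge a (inl x) (inr y)].
Definition Codom a : set X := [set x | exists y, edge a (inl y) (inr x)].

(* def a = |defect a| and codef a = |codefect a| *)
Definition defect a : set X := ~` Dom a.
Definition codefect a : set X := ~` Codom a.

Definition FX : set (brauer X) :=
  gen ([set e | e * e = e] `|` [set g | unit_elt g]).
End BrauerSets.

Arguments FX X : clear implicits.

(* Main.v *)
Require Import Defs.
From HB Require Import structures.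
From Stdlib Require Import Relation_Operators.
From mathcomp Require Import all_boot.
From mathcomp Require Import mathcomp_extra boolp classical_sets functions cardinality.

Set Implicit Arguments.
Unset Strict Implicit.
Unset Printing Implicit Defensive.

Local Open Scope classical_set_scope.
Local Open Scope card_scope.
Local Open Scope group_scope.

(** Reflection in the horizontal axis is an anti-automorphism exchanging left
    and right units, defect and codefect, so each argument below is needed on
    one side only. An element [a] is a right unit exactly when [Dom a] is
    everything: a vertex off all transversals stays off them in [a * b], while
    a full domain gives [a * star a = 1].

    Sufficiency. Let [a] be a right unit and [b] a left unit, with
    [codefect a] and [defect b] of cardinality |X|. The transversals of [a]
    place a copy of X, with |X| points to spare, in the middle row, and those
    of [b] place another. Any [c] is then [a * e * p * f * b] ([factorisation]):
    the idempotent [e] installs the upper hooks of [c] on the first copy and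
    kills its isolated upper vertices, [f] does the same for the lower ones on
    the second copy, and [p] is a permutation carrying the transversals of [c]
    from one copy to the other. The spare room is what allows this partial
    bijection to be extended to a permutation of X ([extend_to_unit]).

    Necessity. A right unit that is not a unit, with codefect of full size,
    exists ([exists_right_unit]); with its reflection it forms a pair as above,
    so the relative rank is at most 2. When it is written as a product of
    generators, every prefix is again a right unit. As an idempotent right unit is 1, one of
    the elements adjoined to [FX X] is a right unit but not a left unit
    ([generator_right_unit]); dually one is a left unit but not a right unit,
    and these two differ, so the relative rank is at least 2. For the
    cardinalities, call a set small when X does not embed in it. Along those
    prefixes the codefect stays small as long as each new factor is idempotent
    or has small codefect; if [p] has small codefect, [e] is idempotent
    and [p * e] is a right unit, then [e] has small defect, because every point
    of [defect e] lies in [codefect p] or is hooked to it by [e]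
    ([idem_defect_cover]), and the codefect of an idempotent is no larger than
    its defect ([idem_codefect_le]). So one of the adjoined elements has
    codefect of full size ([generator_codefect]); among a right unit and a
    left unit it can only be the former.

    This needs two facts of cardinal arithmetic: a union of two small sets is
    small, and an infinite X injects into itself with complement of size |X|.
    Both follow from the comparability of cardinals and from a partition of
    any infinite set into countably infinite pieces. *)

(** * Cardinal arithmetic *)

(** Injections given as relations avoid both a default value in the codomain and
    the choice of a function. *)
Lemma card_le_relP T U (A : set T) (B : set U) :
  A #<= B <-> exists R : T -> U -> Prop,
    (forall x, A x -> exists2 y, B y & R x y) /\
    (forall x x' y, R x y -> R x' y -> x = x').
Proof.
split=> [/card_leP[f]|[R [Rtot Rinj]]].
  exists (fun x y => exists2 a : A, val a = x & val (f a) = y).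
  split=> [x Ax|_ _ y [a <- fa] [a' <- fa']].
    pose a : A := exist _ x (mem_set Ax).
    by exists (val (f a)); [exact: set_valP|exists a].
  congr val; apply: (@inj _ _ _ f) => //; rewrite ?inE //.
  by apply: val_inj; rewrite fa.
have [->//|/set0P[x0 /Rtot[y0 _ _]]] := eqVneq A set0.
have /choice[f fP] x : exists y, A x -> B y /\ R x y.
  have [/Rtot[y By Rxy]|nAx] := EM (A x); first by exists y.
  by exists y0.
have fA : f @` A #= A.
  apply: inj_card_eq => x y /set_mem/fP[_ Rx] /set_mem/fP[_ Ry] e.
  by apply: Rinj Rx _; rewrite e.
rewrite -(card_le_eql fA); apply: subset_card_le => _ [x Ax <-].
by have [] := fP x Ax.
Qed.

Lemma card_eq_rel T U (A : set T) (B : set U) : A #= B ->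
  exists R : T -> U -> Prop,
    [/\ forall x, A x -> exists y, R x y,
        forall y, B y -> exists x, R x y,
        forall x y, R x y -> A x /\ B y,
        forall x y y', R x y -> R x y' -> y = y' &
        forall x x' y, R x y -> R x' y -> x = x'].
Proof.
move=> /card_bijP[f [g fK gK]].
exists (fun x y => exists2 a : A, val a = x & val (f a) = y); split.
- move=> x Ax; pose a : A := exist _ x (mem_set Ax).
  by exists (val (f a)), a.
- move=> y By; pose b : B := exist _ y (mem_set By).
  by exists (val (g b)); exists (g b) => //; rewrite gK.
- by move=> _ _ [a <- <-]; split; exact: set_valP.
- by move=> _ y y' [a <- <-] [a' /val_inj -> <-].
by move=> _ _ _ [a <- <-] [a' <- /val_inj/(can_inj fK) ->].
Qed.

(** Take a maximal partial bijection between [A] and [B]: by maximality it is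
    total on one side or the other. *)
Lemma card_le_total T U (A : set T) (B : set U) : A #<= B \/ B #<= A.
Proof.
pose P (G : set (T * U)) := (forall p, G p -> A p.1 /\ B p.2) /\
  (forall p q, G p -> G q -> p.1 = q.1 <-> p.2 = q.2).
have [F FP totF|G [[GAB Ginj] Gmax]] := @Zorn_bigcup _ P.
  split=> [p [G /FP[+ _] Gp]|p q [G FG Gp] [H FH Hq]]; first exact.
  have [GH|HG] := totF _ _ FG FH.
    by apply: (FP _ FH).2 => //; exact: GH.
  by apply: (FP _ FG).2 => //; exact: HG.
have [AG|/existsNP[x /not_implyP[Ax nx]]] :=
    EM (forall x, A x -> exists y, G (x, y)).
  left; apply/card_le_relP; exists (fun x y => G (x, y)); split.
    by move=> x /AG[y Gxy]; exists y => //; have [] := GAB _ Gxy.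
  by move=> x x' y h h'; apply/(Ginj (x, y) (x', y)).
have [BG|/existsNP[y /not_implyP[By ny]]] :=
    EM (forall y, B y -> exists x, G (x, y)).
  right; apply/card_le_relP; exists (fun y x => G (x, y)); split.
    by move=> z /BG[w Gwz]; exists w => //; have [] := GAB _ Gwz.
  by move=> z z' w h h'; apply/(Ginj (w, z) (w, z')).
exfalso; apply: (Gmax (G `|` [set (x, y)])).
  split; last by move=> /(_ (x, y) (or_intror erefl)) ?; apply: nx; exists y.
  by move=> p; left.
have nG p : G p -> p.1 <> x /\ p.2 <> y.
  case: p => u v /= Gp; split=> e; subst.
    by apply: nx; exists v.
  by apply: ny; exists u.
split=> [p [/GAB//|->//]|p q [Gp|->] [Gq|->]] //=; first exact: Ginj.
  by have [] := nG p Gp.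
by have [n1 n2] := nG q Gq; split=> /esym.
Qed.

(** Each [f] in [G] enumerates one piece of a partition of [A] into countably
    infinite pieces. A maximal disjoint family of such pieces leaves out only a
    finite set, which is then absorbed into one of the pieces. *)
Lemma nat_partition T (A : set T) : infinite_set A ->
  exists G : set (nat -> T),
    (forall f g m n, G f -> G g -> f m = g n -> f = g /\ m = n) /\
    (forall x, A x <-> exists f n, G f /\ f n = x).
Proof.
move=> Ainf.
pose P (G : set (nat -> T)) := (forall f n, G f -> A (f n)) /\
  (forall f g m n, G f -> G g -> f m = g n -> f = g /\ m = n).
have [F FP totF|G [[GA Ginj] Gmax]] := @Zorn_bigcup _ P.
  split=> [f n [G /FP[+ _] Gf]|f g m n [G FG Gf] [H FH Hg]]; first exact.
  have [GH|HG] := totF _ _ FG FH.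
    by apply: (FP _ FH).2 => //; exact: GH.
  by apply: (FP _ FG).2 => //; exact: HG.
pose C := [set x | exists f n, G f /\ f n = x].
have enum (B : set T) : [set: nat] #= B -> exists f : nat -> T,
    injective f /\ B = range f.
  move=> /card_bijP[f [g fK gK]].
  pose n0 (n : nat) : [set: nat] := exist _ n (mem_set I).
  exists (fun n => val (f (n0 n))); split.
    by move=> m n /val_inj/(can_inj fK)[].
  apply/seteqP; split=> [y By|_ [n _ <-]]; last exact: set_valP.
  exists (val (g (exist _ y (mem_set By)))) => //.
  set a := g _; have -> : n0 (val a) = a by apply: val_inj.
  by rewrite /a gK.
have remfin : finite_set (A `\` C).
  apply: contrapT => /infiniteP/card_le_relP[R [Rtot Rinj]].
  have /choice[f fP] n : exists y, (A `\` C) y /\ R n y.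
    by have [y] := Rtot n I; exists y.
  have finj : injective f.
    move=> m n e; apply: Rinj (fP m).2 _; rewrite e; exact: (fP n).2.
  apply: (Gmax (G `|` [set f])).
    split; first by left.
    move=> /(_ f (or_intror erefl)) Gf; apply: (fP 0%N).1.2.
    by exists f, 0%N.
  split=> [g n [/GA//|->]|g h m n [Gg|->] [Gh|->]]; first exact: (fP n).1.1.
  - exact: Ginj.
  - by move=> e; case: ((fP n).1.2); exists g, m.
  - by move=> e; case: ((fP m).1.2); exists h, n.
  by move=> /finj.
have [f0 Gf0] : exists f, G f.
  apply: contrapT => nG; apply: Ainf; apply: sub_finite_set remfin => x Ax.
  by split=> // -[f [n [Gf _]]]; apply: nG; exists f.
have f0inj : injective f0 by move=> m n /(Ginj _ _ _ _ Gf0 Gf0)[].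
have [|f1 [f1inj f1E]] := enum (range f0 `|` (A `\` C)).
  apply/card_eqPle; split.
    apply: card_le_trans (subset_card_le (@subsetUl _ _ _)).
    have := @inj_card_eq _ _ [set: nat] f0 (in2W f0inj).
    by rewrite card_eq_sym => /card_eqPle[].
  suff : countable (range f0 `|` (A `\` C)) by [].
  rewrite -bigcup2E; apply: bigcup_countable => // -[_|[_|//]] /=.
    exact: card_image_le.
  exact: finite_set_countable.
have f1P m g n : f1 m = g n -> G g -> g <> f0 -> False.
  move=> e Gg ne; have : range f1 (f1 m) by exists m.
  rewrite -f1E e => -[[k _ /(Ginj _ _ _ _ Gf0 Gg)[]]|[_]]; first by move/esym.
  by apply; exists g, n.
(* [f1] enumerates the piece of [f0] together with the remainder. *)
exists (f1 |` [set g | G g /\ g <> f0]); split=> [f g m n|x].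
  move=> [->|[Gf nf]] [->|[Gg ng]].
  - by move=> /f1inj.
  - by move=> /f1P; case.
  - by move=> /esym/f1P; case.
  - exact: Ginj.
split=> [Ax|[f [n [[->|[Gf _]] <-]]]]; last exact: GA.
  have [[f [n [Gf fn]]]|nCx] := EM (C x).
    have [e|ne] := EM (f = f0); last by exists f, n; split => //; right.
    have : range f1 x by rewrite -f1E; left; exists n; rewrite -?e.
    by move=> [m _ <-]; exists f1, m; split => //; left.
  have : range f1 x by rewrite -f1E; right.
  by move=> [m _ <-]; exists f1, m; split => //; left.
have : range f1 (f1 n) by exists n.
by rewrite -f1E => -[[m _ <-]|[]//]; exact: GA.
Qed.

(** The larger of [A] and [B], say [B], is infinite, and each of its countable
    pieces has room for two copies of itself: the even positions receive [A],
    the odd ones [B]. *)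
Lemma infinite_card_le_setU T U (X : set U) (A B : set T) :
  infinite_set X -> X #<= A `|` B -> X #<= A \/ X #<= B.
Proof.
move=> Xinf.
wlog AB : A B / A #<= B => [H|XAB].
  have [|BA] := card_le_total A B; first exact: H.
  by rewrite setUC => /(H _ _ BA)[]; [right|left].
right; have Binf : infinite_set B.
  move=> Bfin; apply: Xinf; apply: card_le_finite XAB _.
  by rewrite finite_setU; split => //; apply: card_le_finite AB Bfin.
apply: (card_le_trans XAB).
have [G [Ginj GB]] := nat_partition Binf.
have [S [Stot Sinj]] := (card_le_relP _ _).1 AB.
have dinj m n : m.*2 = n.*2 -> m = n by apply: double_inj.
have dbl m n : m.*2 <> n.*2.+1 by move=> /(congr1 odd); rewrite /= !odd_double.
apply/card_le_relP.
exists (fun x y => exists f n, G f /\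
  ((S x (f n) /\ y = f n.*2) \/ (x = f n /\ y = f n.*2.+1))); split.
  move=> x [/Stot[b /GB[f [n [Gf <-]]] Sx]|/GB[f [n [Gf <-]]]].
    exists (f n.*2); first by apply/GB; exists f, n.*2.
    by exists f, n; split => //; left.
  exists (f n.*2.+1); first by apply/GB; exists f, n.*2.+1.
  by exists f, n; split => //; right.
move=> x x' y [f [n [Gf H]]] [g [m [Gg H']]].
case: H H' => -[h ->] [] [h' /(Ginj _ _ _ _ Gf Gg)[efg]] e; subst g.
- by move/dinj: e h' => <- /(Sinj _ _ _ h).
- by case: (dbl _ _ e).
- by case: (dbl _ _ (esym e)).
- by case: e => /dinj e; rewrite h h' e.
Qed.

(** * Edges of a product *)

Section Products.
Variable X : Type.
Implicit Types a b c : brauer X.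

Definition isolated a (u : X + X) := forall v, ~ edge a u v.

(** Since degrees are at most 1, two graphs agree as soon as the second contains
    the first and has no edge at a vertex isolated in the first. Hence a product
    can be identified without describing all its paths. *)
Lemma brauer_le_eq a b : (forall u v, edge a u v -> edge b u v) ->
  (forall u, isolated a u -> isolated b u) -> a = b.
Proof.
move=> ab iso; apply: brauer_ext => u v; split=> [/ab//|buv].
have [[w auw]|nau] := EM (exists w, edge a u w).
  by rewrite (edge_deg buv (ab _ _ auw)).
case: (iso u _ v buv) => w auw; apply: nau; by exists w.
Qed.

Lemma star_mulg a b : star (a * b) = star b * star a.
Proof. exact: star_mul. Qed.

Lemma star1 : star (1 : brauer X) = 1.
Proof. exact: star_one. Qed.

Lemma isolated_star a u : isolated (star a) (flip u) <-> isolated a u.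
Proof.
split=> H v; last by rewrite /= /star_edge flipK; exact: H.
by have := H (flip v); rewrite /= /star_edge !flipK.
Qed.

Lemma edge_mul_top a b x y :
  edge a (inl x) (inl y) -> edge (a * b) (inl x) (inl y).
Proof.
move=> h; split; first by move=> e; rewrite e in h; case: (edge_irr h).
exact/rt_step/(prod_edge_vee _ h).
Qed.

Lemma edge_mul_through a b x m y :
  edge a (inl x) (inr m) -> edge b (inl m) (inr y) ->
  edge (a * b) (inl x) (inr y).
Proof.
move=> h k; split=> //; apply: (@rt_trans _ _ _ (Mid m)).
  exact/rt_step/(prod_edge_vee _ h).
exact/rt_step/(prod_edge_wedge _ k).
Qed.

Lemma edge_mul_cap a b x y m n :
  edge a (inl x) (inr m) -> edge b (inl m) (inl n) -> edge a (inl y) (inr n) ->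
  edge (a * b) (inl x) (inl y).
Proof.
move=> xm mn yn; split.
  move=> -[e]; rewrite e in xm; have [e'] := edge_deg xm yn.
  by rewrite e' in mn; case: (edge_irr mn).
apply: (@rt_trans _ _ _ (Mid m)); first exact/rt_step/(prod_edge_vee _ xm).
apply: (@rt_trans _ _ _ (Mid n)); first exact/rt_step/(prod_edge_wedge _ mn).
exact/rt_step/(prod_edge_vee _ (edge_sym yn)).
Qed.

Lemma connected_closed a b (S : vertex3 X -> Prop) p q :
  (forall r s i, S r -> coloured a b i r s -> S s) ->
  prod_connected a b p q -> S p -> S q.
Proof.
move=> cl; elim=> {p q} [p q /prod_edge_coloured[i pq] Sp|//|].
  exact: cl Sp pq.
by move=> p q r _ pq _ qr /pq.
Qed.

(** The component of the top vertex [x] in the product graph is [x] alone or [x]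
    with the middle vertex [m]. *)
Lemma isolated_mul a b x :
  (forall m, edge a (inl x) (inr m) -> isolated b (inl m)) ->
  (forall y, ~ edge a (inl x) (inl y)) ->
  isolated (a * b) (inl x).
Proof.
move=> bm ax v [xv].
move/(@connected_closed _ _ (fun p => p = Top x \/
  exists2 m, edge a (inl x) (inr m) & p = Mid m)) => H.
have [p q i Sp pq||e|[m _]] := H; [|by left| |].
- case: Sp => [ep|[m xm ep]]; subst p.
    case: i pq => -[[u|u] [[w|w] [uw]]] //= [e ->]; subst u.
      by case: (ax w).
    by right; exists w.
  case: i pq => -[[u|u] [w [uw]]] //= [e] ->; subst u.
    by left; rewrite (edge_deg uw (edge_sym xm)).
  by case: (bm _ xm _ uw).
- by apply: xv; apply: (@outer_inj X); rewrite e.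
by case: v {xv H}.
Qed.

Lemma isolated_mull a b x : isolated a (inl x) -> isolated (a * b) (inl x).
Proof. by move=> h; apply: isolated_mul => [m|y] /h. Qed.

Lemma isolated_mulr a b y : isolated b (inr y) -> isolated (a * b) (inr y).
Proof.
move=> /isolated_star h; apply/isolated_star; rewrite star_mulg.
exact: isolated_mull.
Qed.

Lemma isolated_mul_through a b x m : edge a (inl x) (inr m) ->
  isolated b (inl m) -> isolated (a * b) (inl x).
Proof.
move=> xm mb; apply: isolated_mul => [n xn|y xy].
  by have [<-] := edge_deg xm xn.
by have := edge_deg xm xy.
Qed.

Lemma edge_mul_bot a b x y :
  edge b (inr x) (inr y) -> edge (a * b) (inr x) (inr y).
Proof.
by move=> h; have := @edge_mul_top (star b) (star a) x y h; rewrite -star_mulg.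
Qed.

Lemma edge_mul_cup a b x y m n :
  edge b (inl m) (inr x) -> edge a (inr m) (inr n) -> edge b (inl n) (inr y) ->
  edge (a * b) (inr x) (inr y).
Proof.
move=> /edge_sym h1 h2 /edge_sym h3.
by have := @edge_mul_cap (star b) (star a) x y m n h1 h2 h3; rewrite -star_mulg.
Qed.

Lemma isolated_mul_throughr a b m y : edge b (inl m) (inr y) ->
  isolated a (inr m) -> isolated (a * b) (inr y).
Proof.
move=> /edge_sym my /isolated_star h; apply/isolated_star; rewrite star_mulg.
exact: (@isolated_mul_through (star b) (star a) y m my h).
Qed.

Lemma left_unit_star a : left_unit (star a) <-> right_unit a.
Proof.
split=> -[b h]; exists (star b); first by rewrite -[a]starK -star_mulg h star1.
by rewrite -star_mulg h star1.
Qed.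

Lemma right_unit_star a : right_unit (star a) <-> left_unit a.
Proof. by rewrite -left_unit_star starK. Qed.

Lemma Dom_star a : Dom (star a) = Codom a.
Proof. by apply/seteqP; split=> x [y /edge_sym h]; exists y. Qed.

Lemma Codom_star a : Codom (star a) = Dom a.
Proof. by rewrite -Dom_star starK. Qed.

Lemma codefect_star a : codefect (star a) = defect a.
Proof. by rewrite /codefect Codom_star. Qed.

Lemma defect_star a : defect (star a) = codefect a.
Proof. by rewrite /defect Dom_star. Qed.

(** An upper hook or an isolated upper vertex of [a] survives in every product
    [a * b]; conversely [star a] inverts [a] along its transversals. *)
Lemma right_unitP a : right_unit a <-> forall x, Dom a x.
Proof.
split=> [[b ab1] x|aT].
  have one : edge (a * b) (inl x) (inr x) by rewrite ab1.
  apply: contrapT => nx; apply: (@isolated_mul a b x _ _ _ one) => [m xm|y xy].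
    by case: nx; exists m.
  by have := edge_deg one (edge_mul_top b xy).
exists (star a); apply/esym/brauer_le_eq.
  have E x : edge (a * star a) (inl x) (inr x).
    have [y xy] := aT x.
    exact: (@edge_mul_through a (star a) x y x xy (edge_sym xy)).
  by move=> [x|x] [y|y] //= ->; [|apply: (@edge_sym _ (a * star a))]; exact: E.
by move=> [x|x] h; [case: (h (inr x))|case: (h (inl x))].
Qed.

Lemma left_unitP a : left_unit a <-> forall x, Codom a x.
Proof. by rewrite -right_unit_star right_unitP Dom_star. Qed.

End Products.

(** * Two constructions of Brauer graphs *)

Section Constructions.
Variable X : Type.

Section Bijection.
Variable r : X -> X -> Prop.
Hypothesis rf : forall x y y', r x y -> r x y' -> y = y'.
Hypothesis ri : forall x x' y, r x y -> r x' y -> x = x'.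

Definition bij_edge (u v : X + X) : Prop :=
  match u, v with
  | inl x, inr y | inr y, inl x => r x y
  | _, _ => False
  end.

Lemma bij_edge_sym u v : bij_edge u v -> bij_edge v u.
Proof. by case: u v => [x|x] [y|y] /=. Qed.

Lemma bij_edge_irr u : ~ bij_edge u u.
Proof. by case: u => x []. Qed.

Lemma bij_edge_deg u v w : bij_edge u v -> bij_edge u w -> v = w.
Proof.
case: u v w => [x|x] [y|y] [z|z] //= h k.
  by rewrite (rf h k).
by rewrite (ri h k).
Qed.

Definition bij_brauer : brauer X :=
  Brauer bij_edge_sym bij_edge_irr bij_edge_deg.
End Bijection.

Section Hooks.
Variables (K : set X) (h : X -> X -> Prop).
Hypothesis hs : forall x y, h x y -> h y x.
Hypothesis hi : forall x, ~ h x x.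
Hypothesis hf : forall x y z, h x y -> h x z -> y = z.
Hypothesis hK : forall x y, h x y -> ~ K x.

(** The identity on [K], with hooks only above: since the lower vertices outside
    [K] are isolated, the hooks of the second copy are out of reach in the
    square, and the graph is idempotent. *)
Definition hook_edge (u v : X + X) : Prop :=
  match u, v with
  | inl x, inr y | inr x, inl y => x = y /\ K x
  | inl x, inl y => h x y
  | inr _, inr _ => False
  end.

Lemma hook_edge_sym u v : hook_edge u v -> hook_edge v u.
Proof.
by case: u v => [x|x] [y|y] //=; [exact: hs|move=> [-> ?]|move=> [-> ?]].
Qed.

Lemma hook_edge_irr u : ~ hook_edge u u.
Proof. by case: u => [x /hi|x []]. Qed.

Lemma hook_edge_deg u v w : hook_edge u v -> hook_edge u w -> v = w.
Proof.
case: u v w => [x|x] [y|y] [z|z] //=.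
- by move=> xy /(hf xy) ->.
- by move=> /hK xy [].
- by move=> [_ Kx] /hK.
- by move=> [<- _] [<- _].
by move=> [<- _] [<- _].
Qed.

Definition hook_brauer : brauer X :=
  Brauer hook_edge_sym hook_edge_irr hook_edge_deg.

Lemma hook_brauer_idem : hook_brauer * hook_brauer = hook_brauer.
Proof.
apply/esym/brauer_le_eq.
  have E x : K x -> edge (hook_brauer * hook_brauer) (inl x) (inr x).
    by move=> Kx; apply: (@edge_mul_through _ _ _ x x x).
  move=> [x|x] [y|y] //=; first exact: (@edge_mul_top _ hook_brauer).
    by move=> [<- /E].
  by move=> [<- /E]; exact: (@edge_sym _ (hook_brauer * hook_brauer)).
by move=> [x|x]; [exact: isolated_mull|exact: isolated_mulr].
Qed.
End Hooks.
End Constructions.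

(** * Factorising an arbitrary element *)

(** The transversals of [a] carry the upper half of [c] into the middle row of
    [a * e]. Vertices of the middle row outside the codomain of [a] keep their
    vertical edge. *)
Lemma hook_transport (X : Type) (a c : brauer X) : exists e : brauer X,
  [/\ e * e = e,
      forall u v x y, edge c (inl u) (inl v) -> edge a (inl u) (inr x) ->
        edge a (inl v) (inr y) -> edge e (inl x) (inl y),
      forall u x, Dom c u -> edge a (inl u) (inr x) -> edge e (inl x) (inr x) &
      forall u x, isolated c (inl u) -> edge a (inl u) (inr x) ->
        isolated e (inl x)].
Proof.
have ainj u v x : edge a (inl u) (inr x) -> edge a (inl v) (inr x) -> u = v.
  by move=> /edge_sym h /edge_sym k; have [] := edge_deg h k.
pose h x y := exists u v, [/\ edge a (inl u) (inr x), edge a (inl v) (inr y) &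
  edge c (inl u) (inl v)].
pose K := [set x | forall u, edge a (inl u) (inr x) -> Dom c u].
have hs x y : h x y -> h y x.
  by move=> [u [v [ux vy /edge_sym uv]]]; exists v, u.
have hi x : ~ h x x.
  by move=> [u [v [ux /(ainj _ _ _ ux) <- /edge_irr]]].
have hf x y z : h x y -> h x z -> y = z.
  move=> [u [v [ux vy uv]]] [u' [w [/(ainj _ _ _ ux) <- wz uw]]].
  have [e] := edge_deg uv uw; rewrite e in vy.
  by have [] := edge_deg vy wz.
have hK x y : h x y -> ~ K x.
  move=> [u [v [ux vy uv]]] /(_ u ux) [w uw].
  by have := edge_deg uv uw.
exists (hook_brauer hs hi hf hK); split.
- exact: hook_brauer_idem.
- by move=> u v x y uv ux vy; exists u, v.
- move=> u x Du ux; split=> // v vx; by rewrite (ainj _ _ _ vx ux).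
move=> u x iu ux [y|y] /=.
  by move=> [v [w [/(ainj _ _ _ ux) <- _ /iu]]].
by move=> [_ /(_ u ux) [w /iu]].
Qed.

(** Off [D] the permutation is any bijection between the two complements. *)
Lemma extend_to_unit (X : Type) (t : X -> X -> Prop) (D E : set X) :
  (forall x y, t x y -> D x /\ E y) ->
  (forall x, D x -> exists y, t x y) -> (forall y, E y -> exists x, t x y) ->
  (forall x y y', t x y -> t x y' -> y = y') ->
  (forall x x' y, t x y -> t x' y -> x = x') ->
  ~` D #= ~` E ->
  exists2 p : brauer X, unit_elt p &
    forall x y, t x y -> edge p (inl x) (inr y).
Proof.
move=> tDE tD tE tf ti /card_eq_rel[q [qD qE qDE qf qi]].
pose r x y := t x y \/ q x y.
have rf x y y' : r x y -> r x y' -> y = y'.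
  move=> [h|h] [k|k]; [exact: tf h k| | |exact: qf h k].
    by have [Dx _] := tDE _ _ h; have [] := qDE _ _ k.
  by have [Dx _] := tDE _ _ k; have [] := qDE _ _ h.
have ri x x' y : r x y -> r x' y -> x = x'.
  move=> [h|h] [k|k]; [exact: ti h k| | |exact: qi h k].
    by have [_ Dx] := tDE _ _ h; have [] := qDE _ _ k.
  by have [_ Dx] := tDE _ _ k; have [] := qDE _ _ h.
exists (bij_brauer rf ri); last by move=> x y; left.
split; [apply/left_unitP => y|apply/right_unitP => x].
  have [/tE[x xy]|/qE[x xy]] := EM (E y); first by exists x; left.
  by exists x; right.
have [/tD[y xy]|/qD[y xy]] := EM (D x); first by exists y; left.
by exists y; right.
Qed.

(** With [a] and [b] as carriers, [D] and [E] are the middle-row copies of the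
    domain and the codomain of [c]. Their complements contain [codefect a] and
    [defect b], hence are equinumerous. The hooks that [a] and [b] may have on
    the spare vertices do no harm: no path from the outer rows gets there. *)
Lemma factorisation (X : Type) (a b c : brauer X) :
  right_unit a -> left_unit b ->
  codefect a #= [set: X] -> defect b #= [set: X] ->
  exists e p f : brauer X, [/\ e * e = e, unit_elt p, f * f = f &
    c = a * e * p * f * b].
Proof.
move=> /right_unitP aT /left_unitP bT ca db.
have [e [ee ecap eid eiso]] := hook_transport a c.
have [f' [ff fcap fid fiso]] := hook_transport (star b) (star c).
pose t x y := exists u v, [/\ edge a (inl u) (inr x), edge b (inl y) (inr v) &
  edge c (inl u) (inr v)].
pose D := [set x | exists2 u, edge a (inl u) (inr x) & Dom c u].
pose E := [set y | exists2 v, edge b (inl y) (inr v) & Codom c v].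
have ainj u v x : edge a (inl u) (inr x) -> edge a (inl v) (inr x) -> u = v.
  by move=> /edge_sym h /edge_sym k; have [] := edge_deg h k.
have fin (Y Z : set X) : ~` Y `<=` ~` Z -> ~` Y #= [set: X] ->
    ~` Z #= [set: X].
  move=> YZ; rewrite !card_eqPle => -[_ XY]; split; first exact: card_leT.
  exact: card_le_trans XY (subset_card_le YZ).
have DE : ~` D #= ~` E.
  have DX : ~` D #= [set: X].
    by apply: fin ca => x; apply: contra_not => -[u ux _]; exists u.
  have EX : ~` E #= [set: X].
    by apply: fin db => y; apply: contra_not => -[v yv _]; exists v.
  exact: card_eq_trans DX (card_esym EX).
have [|||||p pu pt] := @extend_to_unit X t D E _ _ _ _ _ DE.
- by move=> x y [u [v [ux yv uv]]]; split; [exists u|exists v] => //;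
    [exists v|exists u].
- by move=> x [u ux [v uv]]; have [y yv] := bT v; exists y, u, v.
- by move=> y [v yv [u uv]]; have [x ux] := aT u; exists x, u, v.
- move=> x y y' [u [v [ux yv uv]]] [u' [v' [/(ainj _ _ _ ux) <- yv' uv']]].
  have [ev] := edge_deg uv uv'; rewrite -ev in yv'.
  by have [] := edge_deg (edge_sym yv) (edge_sym yv').
- move=> x x' y [u [v [ux yv uv]]] [u' [v' [ux' yv' uv']]].
  have [ev] := edge_deg yv yv'; rewrite -ev in uv'.
  have [eu] := edge_deg (edge_sym uv) (edge_sym uv'); rewrite -eu in ux'.
  by have [] := edge_deg ux ux'.
have bstar y v : edge b (inl y) (inr v) -> edge (star b) (inl v) (inr y).
  exact: edge_sym.
exists e, p, (star f'); split=> //; first by rewrite -star_mulg ff.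
have T u v : edge c (inl u) (inr v) ->
    edge (a * e * p * star f' * b) (inl u) (inr v).
  move=> uv; have [x ux] := aT u; have [y yv] := bT v.
  have xx := eid u x (ex_intro _ v uv) ux.
  have yy : edge f' (inl y) (inr y).
    apply: (fid v) (bstar _ _ yv); exists u; exact: (edge_sym uv).
  have xy : edge p (inl x) (inr y) by apply: pt; exists u, v.
  apply: edge_mul_through yv; apply: (@edge_mul_through _ _ _ u y y).
    apply: edge_mul_through xy; exact: edge_mul_through ux xx.
  exact: edge_sym yy.
apply: brauer_le_eq => [[u|u] [v|v]|[u|v]].
- move=> uv; rewrite -!mulgA mulgA; apply: edge_mul_top.
  have [x ux] := aT u; have [y vy] := aT v.
  exact: edge_mul_cap ux (ecap _ _ _ _ uv ux vy) vy.
- exact: T.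
- by move=> /edge_sym/T/edge_sym.
- move=> uv; rewrite -!mulgA.
  have [x ux] := bT u; have [y vy] := bT v.
  do 3!apply: edge_mul_bot.
  have fxy : edge (star f') (inr x) (inr y).
    exact: (fcap u v x y uv (bstar _ _ ux) (bstar _ _ vy)).
  exact: edge_mul_cup ux fxy vy.
- move=> iu; have [x ux] := aT u; rewrite -!mulgA.
  apply: (isolated_mul_through ux); apply: isolated_mull.
  exact: eiso iu ux.
move=> iv; have [y yv] := bT v.
apply: (isolated_mul_throughr yv); apply: isolated_mulr.
apply/isolated_star; rewrite starK.
by apply: fiso (bstar _ _ yv); apply/(isolated_star c (inr v)).
Qed.

(** * Generation *)

Section Generation.

Lemma gen_sub (S : semigroupType) (U M : set S) :
  subsemigroup M -> U `<=` M -> gen U `<=` M.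
Proof. exact: smallest_sub. Qed.

Lemma gen_incl (S : semigroupType) (U : set S) : U `<=` gen U.
Proof. exact: sub_gen_smallest. Qed.

Lemma gen_mul (S : semigroupType) (U : set S) : subsemigroup (gen U).
Proof.
move=> a b Ua Ub M MU; apply: MU.1; [exact: Ua|exact: Ub].
Qed.

Lemma idem_right_unit (M : monoidType) (e : M) :
  e * e = e -> right_unit e -> e = 1.
Proof. by move=> ee [b eb]; rewrite -[LHS]mulg1 -eb mulgA ee. Qed.

Lemma right_unit_mul (M : monoidType) (s t : M) :
  right_unit (s * t) -> right_unit s.
Proof. by move=> [b h]; exists (t * b); rewrite mulgA. Qed.

(** A first factor of a right unit is a right unit, hence invertible by
    assumption; cancelling it shows the same of the second factor. *)
Lemma gen_right_unit (M : monoidType) (U : set M) :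
  (forall u, U u -> right_unit u -> left_unit u) ->
  forall s, gen U s -> right_unit s -> left_unit s.
Proof.
move=> H; apply: (@gen_sub M U [set s | right_unit s -> left_unit s]) => //.
move=> s t Rs Rt st.
have rs := right_unit_mul st; have [s' s's] := Rs rs.
have [b stb] := st.
have es : s' = t * b by rewrite -[t * b]mul1g -s's -!mulgA (mulgA s) stb mulg1.
have rt : right_unit t.
  by exists (b * s); rewrite mulgA -es.
have [t' t't] := Rt rt.
by exists (t' * s'); rewrite -mulgA (mulgA s') s's mul1g.
Qed.

Variable X : Type.
Implicit Types a b : brauer X.

Lemma FX_idem a : a * a = a -> FX X a.
Proof. by move=> aa; apply: gen_incl; left. Qed.

Lemma FX_unit a : unit_elt a -> FX X a.
Proof. by move=> aa; apply: gen_incl; right. Qed.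

Lemma gen_FX_sub (U M : set (brauer X)) : subsemigroup M ->
  (forall e, e * e = e -> M e) -> (forall g, unit_elt g -> M g) -> U `<=` M ->
  gen (FX X `|` U) `<=` M.
Proof.
move=> Mm Me Mg UM; apply: gen_sub => // a [|/UM//].
by apply: gen_sub => // {}a [/Me|/Mg].
Qed.

Lemma gen_FX_star (U : set (brauer X)) : gen (FX X `|` U) = setT ->
  gen (FX X `|` (@star X) @` U) = setT.
Proof.
move=> UT; apply/seteqP; split=> // a _; rewrite -[a]starK.
have : gen (FX X `|` U) (star a) by rewrite UT.
apply: (@gen_FX_sub _ [set b | gen (FX X `|` (@star X) @` U) (star b)]) => /=.
- by move=> b c /= hb hc; rewrite star_mulg; apply: gen_mul.
- move=> e ee; apply: gen_incl; left; apply: FX_idem.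
  by rewrite -star_mulg ee.
- move=> g [gl gr]; apply: gen_incl; left; apply: FX_unit.
  by split; [apply/left_unit_star|apply/right_unit_star].
by move=> b Ub; apply: gen_incl; right; exists b.
Qed.

End Generation.

(** * Small codefects *)

Section Small.
Variable X : Type.
Hypothesis Xinf : infinite_set [set: X].

Definition small (A : set X) := ~ ([set: X] #<= A).

Lemma not_small (A : set X) : ~ (A #= [set: X]) -> small A.
Proof.
move=> nA XA; apply: nA; rewrite card_eqPle; split => //; exact: card_leT.
Qed.

Lemma small_le (A B : set X) : A #<= B -> small B -> small A.
Proof. by move=> AB; apply: contra_not => XA; apply: card_le_trans XA AB. Qed.

Lemma small_setU (A B : set X) : small A -> small B -> small (A `|` B).
Proof. by move=> sA sB /(infinite_card_le_setU Xinf)[]. Qed.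

Lemma small_cover (A B C : set X) (R : X -> X -> Prop) :
  (forall x x' y, R x y -> R x' y -> x = x') ->
  (forall x, C x -> A x \/ exists2 y, B y & R x y) ->
  small A -> small B -> small C.
Proof.
move=> Rinj CAB sA sB; apply: (small_le _ (small_setU sA (small_le _ sB))).
  exact: (@subset_card_le _ C (A `|` [set x | exists2 y, B y & R x y])).
by apply/card_le_relP; exists R.
Qed.

(** A lower vertex of [a * b] off all transversals is one for [b], or sits below
    a middle vertex that is one for [a]. *)
Lemma small_codefect_mul (a b : brauer X) :
  small (codefect a) -> small (codefect b) -> small (codefect (a * b)).
Proof.
move=> sa sb.
apply: (small_cover (R := fun y m => edge b (inl m) (inr y)) _ _ sb sa).
  by move=> y y' m h k; have [] := edge_deg h k.
move=> y ny; have [[m my]|nb] := EM (Codom b y); last by left.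
right; exists m => // -[x xm]; apply: ny; exists x.
exact: edge_mul_through xm my.
Qed.

(** If a transversal of [e] joins [x] to [y'] with [x <> y], then [y] is not in
    the domain of [e], as otherwise [e * e] would join [x] elsewhere. So sending
    [x] in the codefect to its partner [y] if there is one, and to itself
    otherwise, lands in the defect. *)
Lemma idem_codefect_le (e : brauer X) : e * e = e -> codefect e #<= defect e.
Proof.
move=> ee.
have move1 x y : edge e (inl x) (inr y) -> x <> y -> ~ Dom e y.
  move=> xy nxy [z yz]; apply: nxy.
  have := edge_mul_through xy yz; rewrite ee => xz.
  have [eyz] := edge_deg xy xz; rewrite -eyz in yz.
  by have [] := edge_deg (edge_sym xy) (edge_sym yz).
apply/card_le_relP.
exists (fun x y => codefect e x /\ x = y \/ edge e (inl x) (inr y)); split.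
  move=> x nx; have [[y xy]|dx] := EM (Dom e x); last by exists x => //; left.
  have nxy : x <> y by move=> exy; apply: nx; exists x; rewrite {2}exy.
  exists y; last by right.
  exact: move1 xy nxy.
move=> x x' y [[cx exy]|xy] [[cx' exy']|xy'].
- by rewrite exy.
- by case: cx; exists x'; rewrite exy.
- by case: cx'; exists x; rewrite exy'.
by have [] := edge_deg (edge_sym xy) (edge_sym xy').
Qed.
End Small.

(** If [y] lies under a transversal of [p] from some [x] but not in [Dom e],
    then [x] can only leave through a hook of [e] to some [z]; were [z] also
    under a transversal of [p], [p * e] would have an upper hook at [x]. *)
Lemma idem_defect_cover (X : Type) (p e : brauer X) : right_unit (p * e) ->
  forall y, defect e y -> codefect p y \/
    exists2 z, codefect p z & edge e (inl y) (inl z).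
Proof.
move=> /right_unitP peT y ny; have [[x xy]|] := EM (Codom p y); last by left.
right; have [x' xx'] := peT x.
apply: contrapT => nz; apply: (isolated_mul_through xy _ xx') => -[z|z] yz.
  apply: nz; exists z => // -[w wz].
  by have := edge_deg xx' (edge_mul_cap xy yz wz).
by apply: ny; exists z.
Qed.

(** * Necessary generators *)

Section Necessity.
Variable X : Type.
Hypothesis Xinf : infinite_set [set: X].

Lemma small0 : small (@set0 X).
Proof. by move=> /card_le_finite/(_ (finite_set0 _)). Qed.

Lemma left_unit_codefect (b : brauer X) : left_unit b -> codefect b = set0.
Proof. by move=> /left_unitP bT; rewrite -subset0 => x []. Qed.

(** Move position [n] of each countable piece to position [2n]; the odd
    positions form the codefect. *)
Lemma exists_right_unit :
  exists2 r : brauer X, right_unit r & codefect r #= [set: X].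
Proof.
have [G [Ginj GX]] := nat_partition Xinf.
have dinj m n : m.*2 = n.*2 -> m = n by apply: double_inj.
pose t x y := exists f n, [/\ G f, f n = x & f n.*2 = y].
have tf x y y' : t x y -> t x y' -> y = y'.
  by move=> [f [m [Gf <- <-]]] [g [n [Gg /(Ginj _ _ _ _ Gg Gf)[-> ->] <-]]].
have ti x x' y : t x y -> t x' y -> x = x'.
  move=> [f [m [Gf <- <-]]] [g [n [Gg <- /(Ginj _ _ _ _ Gg Gf)[->]]]].
  by move=> /dinj ->.
exists (bij_brauer tf ti).
  apply/right_unitP => x; have [f [n [Gf fn]]] := (GX x).1 I.
  by exists (f n.*2), f, n.
rewrite card_eqPle; split; first exact: card_leT.
apply/card_le_relP.
exists (fun x y => exists f n, [/\ G f, f n = x & f n.*2.+1 = y]).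
split=> [x _|x x' y].
  have [f [n [Gf fn]]] := (GX x).1 I.
  exists (f n.*2.+1); last by exists f, n.
  move=> [_ [g [m [Gg _ /(Ginj _ _ _ _ Gg Gf)[_]]]]].
  by move=> /(congr1 odd); rewrite /= !odd_double.
move=> [f [m [Gf <- <-]]] [g [n [Gg <- /(Ginj _ _ _ _ Gg Gf)[->]]]].
by move=> [] /dinj ->.
Qed.

Lemma proper_right_unit (r : brauer X) :
  codefect r #= [set: X] -> ~ left_unit r.
Proof.
by move=> /card_eqPle[_ H] /left_unit_codefect e; apply: small0; rewrite -e.
Qed.

Lemma generator_right_unit (U : set (brauer X)) :
  gen (FX X `|` U) = setT -> exists a, [/\ U a, right_unit a & ~ left_unit a].
Proof.
move=> UT; apply: contrapT => nU.
have [r rr cr] := exists_right_unit; apply: (proper_right_unit cr).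
have : gen (FX X `|` U) r by rewrite UT.
have sub : gen (FX X `|` U) `<=`
    gen [set a : brauer X | right_unit a -> left_unit a].
  apply: gen_FX_sub; first exact: gen_mul.
  - move=> e ee; apply: gen_incl => /= /(idem_right_unit ee) ->.
    by exists 1; rewrite mulg1.
  - by move=> g [gl _]; apply: gen_incl.
  move=> a Ua; apply: gen_incl => /= ra.
  by apply: contrapT => la; apply: nU; exists a.
by move=> /sub /gen_right_unit; apply.
Qed.

(** The set [M] collects the factors [s] such that the codefect of [p * s] is
    small whenever that of [p] is and [p * s] is a right unit. It is closed
    under products since prefixes of right units are right units. *)
Lemma generator_codefect (U : set (brauer X)) :
  gen (FX X `|` U) = setT -> exists2 a, U a & codefect a #= [set: X].
Proof.
move=> UT; apply: contrapT => nU.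
pose M := [set s : brauer X | forall p, right_unit (p * s) ->
  small (codefect p) -> small (codefect (p * s))].
have smallM s : small (codefect s) -> M s.
  by move=> ss p _ sp; apply: small_codefect_mul.
have MT : gen (FX X `|` U) `<=` M.
  apply: gen_FX_sub.
  - move=> s t Ms Mt p; rewrite mulgA => pst sp; apply: Mt => //.
    by apply: Ms => //; exact: right_unit_mul pst.
  - move=> e ee p pe sp; apply: small_codefect_mul => //.
    apply: small_le (idem_codefect_le ee) _.
    pose R y z := edge e (inl y) (inl z).
    apply: (small_cover Xinf (R := R) _ _ sp sp).
      by move=> y y' z /edge_sym h /edge_sym k; have [] := edge_deg h k.
    exact: idem_defect_cover pe.
  - move=> g [/left_unit_codefect e _]; apply: smallM; rewrite e; exact: small0.
  move=> a Ua; apply: smallM; apply: not_small => ca; apply: nU; by exists a.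
have [r rr /card_eqPle[_]] := exists_right_unit; rewrite -[r]mul1g.
apply: MT; rewrite ?UT ?mul1g // left_unit_codefect; first exact: small0.
by exists 1; rewrite mulg1.
Qed.

Lemma generator_left_unit (U : set (brauer X)) :
  gen (FX X `|` U) = setT -> exists a, [/\ U a, left_unit a & ~ right_unit a].
Proof.
move=> /gen_FX_star/generator_right_unit[_ [[a Ua <-]]].
by rewrite right_unit_star left_unit_star => ? ?; exists a.
Qed.

Lemma generator_defect (U : set (brauer X)) :
  gen (FX X `|` U) = setT -> exists2 a, U a & defect a #= [set: X].
Proof.
move=> /gen_FX_star/generator_codefect[_ [a Ua <-]].
by rewrite codefect_star; exists a.
Qed.

Lemma generating_pair (a b : brauer X) : gen (FX X `|` [set a; b]) = setT ->
  right_unit a -> ~ right_unit b -> left_unit b -> ~ left_unit a ->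
  codefect a #= [set: X] /\ defect b #= [set: X].
Proof.
move=> abT ra nb lb na; split.
  have [_ [->//|-> cb]] := generator_codefect abT.
  by case: (proper_right_unit cb).
have [_ [->|->//]] := generator_defect abT.
rewrite -codefect_star => /proper_right_unit.
by rewrite left_unit_star.
Qed.
End Necessity.

(** * The theorem *)

Lemma units_generating_pair (X : Type) (a b : brauer X) :
  right_unit a -> left_unit b ->
  codefect a #= [set: X] -> defect b #= [set: X] ->
  gen (FX X `|` [set a; b]) = setT.
Proof.
move=> ra lb ca db; apply/seteqP; split=> // c _.
have [e [p [f [ee pu ff ->]]]] := factorisation c ra lb ca db.
have F x : FX X x -> gen (FX X `|` [set a; b]) x.
  by move=> Fx; apply: gen_incl; left.
do !apply: gen_mul.
- by apply: gen_incl; right; left.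
- exact: F (FX_idem ee).
- exact: F (FX_unit pu).
- exact: F (FX_idem ff).
by apply: gen_incl; right; right.
Qed.

Lemma card_pair (T : Type) (a b : T) : a <> b -> [set a; b] #= `I_2.
Proof.
move=> ab; pose f n := if n is 0%N then a else b.
have -> : [set a; b] = f @` `I_2.
  apply/seteqP; split=> [x [->|->]|_ [[|n] _ <-]]; last by right.
  - by exists 0%N.
  - by exists 1%N.
  by left.
by apply: inj_card_eq => -[|[|m]] [|[|n]]; rewrite ?inE //= => _ _ e; case: ab.
Qed.

Theorem theorem6p3 (X : Type) (hX : infinite_set [set: X]) :
  relrank_eq (FX X) `I_2 /\
  (forall a b : brauer X,
     gen (FX X `|` [set a; b]) = [set: brauer X] <->
     ([/\ right_unit a, left_unit b,
          codefect a #= [set: X] & defect b #= [set: X]] \/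
      [/\ right_unit b, left_unit a,
          codefect b #= [set: X] & defect a #= [set: X]])).
Proof.
split; [split|move=> a b; split].
- have [r rr cr] := exists_right_unit hX.
  exists [set r; star r].
    apply: units_generating_pair => //; first exact/left_unit_star.
    by rewrite defect_star.
  apply: card_pair => e; apply: (proper_right_unit hX cr).
  by apply/right_unit_star; rewrite -e.
- move=> U UT; have [a [Ua ra na]] := generator_right_unit hX UT.
  have [b [Ub lb nb]] := generator_left_unit hX UT.
  have ab : a <> b by move=> e; apply: na; rewrite e.
  rewrite -(card_le_eql (card_pair ab)); apply: subset_card_le.
  by move=> x [->|->].
- move=> abT; have [c [Uc rc nc]] := generator_right_unit hX abT.
  have [d [Ud ld nd]] := generator_left_unit hX abT.
  have cd : c <> d by move=> e; apply: nc; rewrite e.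
  case: Uc rc nc cd => -> rc nc cd; case: Ud ld nd cd => -> ld nd cd.
  + by case: cd.
  + by left; have [] := generating_pair hX abT rc nd ld nc.
  + rewrite [[set a; b]]setUC in abT.
    by right; have [] := generating_pair hX abT rc nd ld nc.
  by case: cd.
move=> [] [ra lb ca db]; [|rewrite [[set a; b]]setUC].
  exact: units_generating_pair.
exact: units_generating_pair.
Qed.
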